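(* Let $a,b\in\mathbb{Z}\setminus\{0\}$ with $\gcd(a,b)=1$. Then $$a\,(a^{-1})_{b}+b\,(b^{-1})_{a}=1+a\,b .$$
   Context: Modular inverse notation: for nonzero integers $a,m$ with $\gcd(a,m)=1$, the integer $(a^{-1})_m$ is defined as follows. (i) If $m>1$, $(a^{-1})_m$ is the unique integer $x$ with $1\le x\le m-1$ and $ax\equiv 1\pmod m$. (ii) If $m<-1$, $(a^{-1})_m$ is the unique integer $x$ with $m+1\le x\le -1$ and $ax\equiv 1\pmod m$. (iii) If $|m|=1$, $(a^{-1})_m=\tfrac12|m|(\operatorname{sgn}(m)-\operatorname{sgn}(a))+\operatorname{sgn}(a)$; that is, for $m=1$ it equals $1$ if $a>0$ and $0$ if $a<0$, and for $m=-1$ it equals $0$ if $a>0$ and $-1$ if $a<0$. It is undefined if $am=0$ or $\gcd(a,m)\neq1$. *)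

(* Defs.v *)
From mathcomp Require Import all_boot all_order all_algebra.
From mathcomp Require Import boolp classical_sets.

Set Implicit Arguments.
Unset Strict Implicit.
Unset Printing Implicit Defensive.

Import Order.TTheory GRing.Theory Num.Theory.
Local Open Scope classical_set_scope.
Local Open Scope ring_scope.

(* [modinv a m] is (a^-1)_m.  It is total; its value is meaningful only when
   [a != 0], [m != 0] and [coprimez a m], in which case the sets below are
   singletons by [modinv_gt1_ex], [modinv_ltN1_ex] and [modinv_uniq].  In the
   last branch, [m = 1] or [m = -1] and the division by 2 is then exact. *)
Definition modinv (a m : int) : int :=
  if 1 < m then
    xget 0 [set x : int | 1 <= x <= m - 1 /\ (a * x = 1 %[mod m])%Z]
  else if m < -1 then
    xget 0 [set x : int | m + 1 <= x <= -1 /\ (a * x = 1 %[mod m])%Z]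
  else
    (`|m| * (sgz m - sgz a) %/ 2)%Z + sgz a.

Lemma modinv_gt1_ex (a m : int) : 1 < m -> coprimez a m ->
  exists x : int, 1 <= x <= m - 1 /\ (a * x = 1 %[mod m])%Z.
Proof.
move=> m1 /coprimezP[[u v] /= uv1].
have m0 : 0 < m by apply: lt_trans m1.
have um : (a * (u %% m)%Z = 1 %[mod m])%Z.
  by rewrite modzMmr mulrC -uv1 addrC modzMDl.
have x0 : 0 <= (u %% m)%Z by rewrite modz_ge0 ?gt_eqF.
have xm : (u %% m)%Z < m by apply: ltz_pmod.
move: (u %% m)%Z um x0 xm => x ax x0 xm; exists x; split=> //.
rewrite lerBrDr lezD1 xm andbT -gtz0_ge1 lt_neqAle x0 andbT.
by apply/eqP => xE; move: ax; rewrite -xE mulr0 mod0z modz_small.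
Qed.

Lemma modinv_ltN1_ex (a m : int) : m < -1 -> coprimez a m ->
  exists x : int, m + 1 <= x <= -1 /\ (a * x = 1 %[mod m])%Z.
Proof.
move=> mN1 am; have m1 : 1 < - m by rewrite ltrNr.
have am' : coprimez (- a) (- m) by rewrite coprimezN coprimeNz.
have [x [/andP[x1 xm] ax]] := modinv_gt1_ex m1 am'.
exists (- x); split; last by rewrite mulrN -mulNr -modzN ax modzN.
by rewrite lerN2 x1 andbT lerNr opprD.
Qed.

Lemma modinv_uniq (a m x y : int) : coprimez a m -> `|x - y| < `|m| ->
  (a * x = 1 %[mod m])%Z -> (a * y = 1 %[mod m])%Z -> x = y.
Proof.
move=> am xy ax ay; apply/eqP; rewrite -subr_eq0; apply/eqP.
have : (m %| x - y)%Z.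
  rewrite -(@Gauss_dvdzr _ a) 1?coprimez_sym // mulrBr -eqz_mod_dvd.
  by rewrite ax ay.
case/dvdzP=> k kE; move: xy; rewrite kE normrM.
have [->|k0] := eqVneq k 0; first by rewrite !mul0r.
have k1 : 1 <= `|k| by rewrite -gtz0_ge1 normr_gt0.
by rewrite ltNge ler_peMl.
Qed.

Lemma modinv_gt1P (a m : int) : 1 < m -> coprimez a m ->
  1 <= modinv a m <= m - 1 /\ (a * modinv a m = 1 %[mod m])%Z.
Proof.
move=> m1 am; rewrite /modinv m1.
have [x xP] := modinv_gt1_ex m1 am.
by case: xgetP => [_ -> []|/(_ x)].
Qed.

Lemma modinv_ltN1P (a m : int) : m < -1 -> coprimez a m ->
  m + 1 <= modinv a m <= -1 /\ (a * modinv a m = 1 %[mod m])%Z.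
Proof.
move=> mN1 am; rewrite /modinv mN1 ltNge (ltW (lt_trans mN1 _)) //=.
have [x xP] := modinv_ltN1_ex mN1 am.
by case: xgetP => [_ -> []|/(_ x)].
Qed.

Lemma modinv_1 (a : int) : a != 0 -> modinv a 1 = if 0 < a then 1 else 0.
Proof. by rewrite /modinv; case: (sgzP a) => [->||]. Qed.

Lemma modinv_N1 (a : int) : a != 0 -> modinv a (-1) = if 0 < a then 0 else -1.
Proof. by rewrite /modinv; case: (sgzP a) => [->||]. Qed.

(* Main.v *)
(* Both [a (a^-1)_b] and [b (b^-1)_a] lie in [1, ab] when ab > 0 and in
   [ab + 1, 0] when ab < 0; the convention for moduli 1 and -1 is what makes
   this hold there too.  Their sum S satisfies S = 1 modulo a and modulo b,
   hence S = 1 + t ab by coprimality, and these bounds force t = 1. *)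
Require Import Defs.
From mathcomp Require Import all_boot all_order all_algebra zify.

Set Implicit Arguments.
Unset Strict Implicit.
Unset Printing Implicit Defensive.

Import Order.TTheory GRing.Theory Num.Theory.
Local Open Scope ring_scope.

Lemma dvdz_mul_modinv (a m : int) : a != 0 -> m != 0 -> coprimez a m ->
  (m %| a * modinv a m - 1)%Z.
Proof.
move=> a0 m0 am; have [m1|[m1|[->|->]]] : 1 < m \/ m < -1 \/ m = 1 \/ m = -1 by lia.
- by rewrite -eqz_mod_dvd; apply/eqP; case: (modinv_gt1P m1 am).
- by rewrite -eqz_mod_dvd; apply/eqP; case: (modinv_ltN1P m1 am).
- by rewrite dvd1z.
- by rewrite dvdzE dvd1n.
Qed.

(** For [|m| > 1], multiply the range of [modinv a m] by [a], which has absolute value at least 1.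
    The upper bounds [a * m] and [0] are attained exactly when [m] is 1 or -1. *)
Lemma mul_modinv_bounds (a m : int) : a != 0 -> m != 0 -> coprimez a m ->
  if 0 < a * m then 1 <= a * modinv a m <= a * m
  else a * m + 1 <= a * modinv a m <= 0.
Proof.
move=> a0 m0 am; have [m1|[m1|[->|->]]] : 1 < m \/ m < -1 \/ m = 1 \/ m = -1 by lia.
- by have [/andP[x1 xm] _] := modinv_gt1P m1 am; case: ifP => ?; nia.
- by have [/andP[x1 xm] _] := modinv_ltN1P m1 am; case: ifP => ?; nia.
- by rewrite modinv_1 // mulr1; case: (ltgtP 0 a) a0 => //= ha _; lia.
- by rewrite modinv_N1 // mulrN1 oppr_gt0; case: (ltgtP 0 a) a0 => //= ha _; lia.
Qed.

Theorem theorem2p3 (a b : int) (a_neq0 : a != 0) (b_neq0 : b != 0)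
    (coprime_ab : coprimez a b) :
  a * modinv a b + b * modinv b a = 1 + a * b.
Proof.
have coprime_ba : coprimez b a by rewrite coprimez_sym.
have := mul_modinv_bounds b_neq0 a_neq0 coprime_ba; rewrite (mulrC b a).
have := mul_modinv_bounds a_neq0 b_neq0 coprime_ab.
have : (a * b %| a * modinv a b + b * modinv b a - 1)%Z.
  rewrite Gauss_dvdz //; apply/andP; split.
    by rewrite -addrA rpredD ?dvdz_mulr ?dvdz_mul_modinv.
  by rewrite addrAC rpredD ?dvdz_mulr ?dvdz_mul_modinv.
case/dvdzP=> t; have : a * b != 0 by rewrite mulf_neq0.
move: (a * b) (a * modinv a b) (b * modinv b a) => n x y n0 tE.
move=> x_bounds y_bounds; suff t1 : t = 1 by move: tE; rewrite t1; lia.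
(* Adding the bounds puts [t * n = x + y - 1] in [[1, 2n - 1]] if [n > 0] and in [[2n + 1, -1]] if
   [n < 0], so strictly between 0 and [2n] either way. *)
suff : 0 < t < 2 by lia.
by case: (ltgtP 0 n) n0 x_bounds y_bounds => //= n_sgn _ ? ?; nia.
Qed.
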